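(* Let $F/K(x)$ be given by $y^m=f(x)$ with $f\in K[x]$ separable of degree $r$ (so all $\lambda_i=1$), and assume the genus of $F$ is at least $1$. Let $P$ be the place of $F$ over $x=\alpha$ where $\alpha$ is a root of $f$ (this place is totally ramified). Then the set of gaps at $P$ is $$G(P)=\Big\{1+i+mj \;:\; 0\le i\le m-2-\lfloor m/r\rfloor,\ 0\le j\le r-2-\Big\lfloor\frac{r(i+1)}{m}\Big\rfloor\Big\}.$$
   Context: $K$ is algebraically closed of characteristic $p\ge0$, $m\ge2$, $p\nmid m$. An integer $s\ge1$ is a gap at a place $Q$ if there is no $z\in F$ with pole divisor exactly $sQ$. *)

(* Defs.v *)
From Stdlib Require List.
From HB Require Import structures.
From mathcomp Require Import all_boot all_order all_algebra all_field.
Set Implicit Arguments. Unset Strict Implicit. Unset Printing Implicit Defensive.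
Import GRing.Theory.
Local Open Scope ring_scope.

(* A place of F/K, given by its valuation ring O: K ⊆ O ⊊ F, and z ∈ O or z^-1 ∈ O. *)
Definition is_place (K F : fieldType) (iota : K -> F) (O : pred F) : Prop :=
  (forall c, iota c \in O) /\
  (forall a b, a \in O -> b \in O -> [/\ a + b \in O, a * b \in O & - a \in O]) /\
  (exists z, z \notin O) /\
  (forall z, z \in O \/ z^-1 \in O).

Definition same_place (F : fieldType) (O Q : pred F) : Prop :=
  forall w, (w \in O) = (w \in Q).

Definition unit_in (F : fieldType) (O : pred F) (z : F) : Prop :=
  [/\ z != 0, z \in O & z^-1 \in O].

Definition maxideal (F : fieldType) (O : pred F) (z : F) : Prop :=
  z \in O /\ ~ unit_in O z.

Definition uniformizer (F : fieldType) (O : pred F) (t : F) : Prop :=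
  maxideal O t /\ (forall w, maxideal O w -> exists2 u, u \in O & w = t * u).

Definition ord (F : fieldType) (O : pred F) (z : F) (n : int) : Prop :=
  exists t u, [/\ uniformizer O t, unit_in O u & z = t ^ n * u].

Definition pole_divisor_is (K F : fieldType) (iota : K -> F) (z : F) (O : pred F) (s : nat) : Prop :=
  ord O z (- (s%:Z)) /\
  (forall Q, is_place iota Q -> ~ same_place Q O -> z \in Q).

Definition gap (K F : fieldType) (iota : K -> F) (O : pred F) (s : nat) : Prop :=
  (1 <= s)%N /\ ~ (exists z, pole_divisor_is iota z O s).

Definition is_divisor (K F : fieldType) (iota : K -> F) (D : seq (pred F * int)) : Prop :=
  (forall e, List.In e D -> is_place iota e.1) /\
  (forall i j, (i < j < size D)%N ->
     ~ same_place (nth ((fun _ : F => false) : pred F, 0%:Z) D i).1 (nth ((fun _ : F => false) : pred F, 0%:Z) D j).1).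

Definition in_L (K F : fieldType) (iota : K -> F) (D : seq (pred F * int)) (z : F) : Prop :=
  z = 0 \/
  (forall Q, is_place iota Q -> forall n, ord Q z n ->
     (forall e, List.In e D -> same_place e.1 Q -> 0 <= n + e.2) /\
     ((forall e, List.In e D -> ~ same_place e.1 Q) -> 0 <= n)).

(* degree of a divisor; all places have degree one since K is algebraically closed *)
Definition deg_div (F : fieldType) (D : seq (pred F * int)) : int :=
  \sum_(e <- D) e.2.

Definition K_indep (K F : fieldType) (iota : K -> F) (n : nat) (z : 'I_n -> F) : Prop :=
  forall c : 'I_n -> K, \sum_(i < n) iota (c i) * z i = 0 -> forall i, c i = 0.

(* genus g = max_D (deg D - l(D) + 1); g >= 1 iff some D has l(D) <= deg D *)
Definition genus_ge1 (K F : fieldType) (iota : K -> F) : Prop :=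
  exists (D : seq (pred F * int)) (n : nat),
    [/\ is_divisor iota D, deg_div D = n%:Z &
        ~ (exists z : 'I_n.+1 -> F, (forall i, in_L iota D (z i)) /\ K_indep iota z)].

Definition eval2 (K F : fieldType) (iota : K -> F) (x y : F) (p : {poly {poly K}}) : F :=
  \sum_(i < size p) (map_poly iota p`_i).[x] * y ^+ i.

(* Main.v *)
Require Import Defs.
From HB Require Import structures.
From mathcomp Require Import all_boot all_order all_algebra all_field.
From mathcomp Require Import cyclic boolp classical_sets zify ring.
Import Pdiv.CommonRing Pdiv.RingMonic.
Set Implicit Arguments. Unset Strict Implicit. Unset Printing Implicit Defensive.
Import Order.TTheory GRing.Theory Num.Theory.
Local Open Scope ring_scope.

(** Write [s = m b - a] with [0 <= a < m]; the claim is that [s] is a gap at [P]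
    iff [m b < r a].

    At any place above [alpha] the function [y] is a uniformizer and
    [x - alpha] has order [m], so the terms of [sum_(k < m) h_k(x) y^k] have
    orders that differ modulo [m].  Hence [P] is the only place above [alpha],
    [1, y, ..., y^(m-1)] is a basis of [F] over [K(x)], and [y |-> zeta y] is an
    automorphism of [F] for each [m]-th root of unity [zeta].

    If [r a <= m b], then [y^a / (x - alpha)^b] has pole divisor [s P].
    Conversely, let [z = sum_(k < m) h_k(x) y^k] have pole divisor [s P].
    Averaging the conjugates of [z] shows that [h_a(x) y^a] is regular away from
    [P], and [h_a] has a pole of order [b] at [alpha].  Evaluating at places
    above every [beta != alpha] shows that [h_a] has no other finite pole, and at
    a place above infinity that [r a <= - m deg h_a <= m b].  These places exist
    by Chevalley's argument: a subring maximal among those that contain [K] and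
    [t] but not [1/t] is a valuation ring. *)

(** * Places *)

Section Place.
Variables (K F : fieldType) (iota : {rmorphism K -> F}) (O : pred F).
Hypothesis placeO : is_place iota O.

Lemma place_const c : iota c \in O. Proof. by case: placeO. Qed.

Lemma placeD a b : a \in O -> b \in O -> a + b \in O.
Proof. by case: placeO => _ [H _] Oa Ob; case: (H a b Oa Ob). Qed.

Lemma placeM a b : a \in O -> b \in O -> a * b \in O.
Proof. by case: placeO => _ [H _] Oa Ob; case: (H a b Oa Ob). Qed.

Lemma placeN a : a \in O -> - a \in O.
Proof. by case: placeO => _ [H _] Oa; case: (H a a Oa Oa). Qed.

Lemma placeV a : a \notin O -> a^-1 \in O.
Proof. by case: placeO => _ [_ [_ /(_ a)[->|]]]. Qed.

Lemma place0 : 0 \in O. Proof. by rewrite -(rmorph0 iota) place_const. Qed.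

Lemma place1 : 1 \in O. Proof. by rewrite -(rmorph1 iota) place_const. Qed.

Lemma placeX a n : a \in O -> a ^+ n \in O.
Proof.
move=> Oa; elim: n => [|n IHn]; first by rewrite expr0 place1.
by rewrite exprS placeM.
Qed.

Lemma place_sum (I : Type) (s : seq I) (Q : pred I) (G : I -> F) :
  (forall i, Q i -> G i \in O) -> \sum_(i <- s | Q i) G i \in O.
Proof.
by move=> OG; apply: (big_ind (fun z => z \in O)) => //; [exact: place0 | exact: placeD].
Qed.

(** Valuation rings are integrally closed: if [a] were outside [O], then [a^-1] would lie in [O],
    and multiplying [a ^+ n] by powers of [a^-1] would bring [a] back into [O]. *)
Lemma place_root a n : (0 < n)%N -> a ^+ n \in O -> a \in O.
Proof.
case: n => // n _ Oan; apply: contraT => nOa; case/negP: (nOa).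
have a0 : a != 0 by apply: contraNneq nOa => ->; rewrite place0.
have -> : a = a ^+ n.+1 * (a^-1) ^+ n.
  by rewrite exprS -mulrA -exprMn divff // expr1n mulr1.
by rewrite placeM // placeX // placeV.
Qed.

Lemma place_horner (p : {poly K}) a : a \in O -> (map_poly iota p).[a] \in O.
Proof.
move=> Oa; rewrite horner_coef; apply: place_sum => i _.
by rewrite coef_map placeM ?place_const ?placeX.
Qed.

(** The case [a = 0] stands apart because [0^-1 = 0] does lie in [O]. *)
Lemma maxidealE a : maxideal O a <-> a \in O /\ (a = 0 \/ a^-1 \notin O).
Proof.
split=> [[Oa nu]|[Oa nu]]; split=> //.
  have [->|a0] := eqVneq a 0; first by left.
  by right; apply/negP => OaV; apply: nu.
by case=> a0 _ OaV; case: nu => [/eqP|/negP]; [rewrite (negPf a0)|apply].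
Qed.

Lemma maxideal_place a : maxideal O a -> a \in O. Proof. by case. Qed.

Lemma maxideal_nunit a : unit_in O a -> ~ maxideal O a.
Proof. by move=> ua [_]. Qed.

Lemma unit_place a : unit_in O a -> a \in O. Proof. by case. Qed.

Lemma unit_neq0 a : unit_in O a -> a != 0. Proof. by case. Qed.

Lemma maxideal_unit a : a \in O -> maxideal O a \/ unit_in O a.
Proof.
move=> Oa; have [->|a0] := eqVneq a 0.
  by left; apply/maxidealE; split; [exact: place0 | left].
case OaV: (a^-1 \in O); first by right.
by left; apply/maxidealE; split => //; right; rewrite OaV.
Qed.

Lemma maxidealV a : a \notin O -> maxideal O a^-1.
Proof.
by move=> nOa; apply/maxidealE; split; [exact: placeV | right; rewrite invrK].
Qed.

Lemma maxideal_notin a : a != 0 -> maxideal O a -> a^-1 \notin O.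
Proof. by move=> a0 /maxidealE[_ [/eqP|//]]; rewrite (negPf a0). Qed.

Lemma unitM a b : unit_in O a -> unit_in O b -> unit_in O (a * b).
Proof.
by move=> [a0 Oa OaV] [b0 Ob ObV]; split; rewrite ?mulf_neq0 ?invfM ?placeM.
Qed.

Lemma unitV a : unit_in O a -> unit_in O a^-1.
Proof. by move=> [a0 Oa OaV]; split; rewrite ?invr_eq0 ?invrK. Qed.

Lemma unit1 : unit_in O 1.
Proof. by split; rewrite ?invr1 ?oner_neq0 ?place1. Qed.

Lemma unitX a n : unit_in O a -> unit_in O (a ^+ n).
Proof.
move=> ua; elim: n => [|n IHn]; first by rewrite expr0; exact: unit1.
by rewrite exprS; exact: unitM.
Qed.

Lemma unit_const c : c != 0 -> unit_in O (iota c).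
Proof. by move=> c0; split; rewrite ?fmorph_eq0 -?fmorphV ?place_const. Qed.

Lemma maxidealM a b : maxideal O a -> b \in O -> maxideal O (a * b).
Proof.
move=> ma Ob; have [//|uab] := maxideal_unit (placeM (maxideal_place ma) Ob).
have [ab0 _ OabV] := uab; move: ab0; rewrite mulf_eq0 negb_or => /andP[a0 b0].
case/negP: (maxideal_notin a0 ma).
have -> : a^-1 = (a * b)^-1 * b by rewrite invfM divfK.
exact: placeM.
Qed.

Lemma maxidealX a n : maxideal O a -> (0 < n)%N -> maxideal O (a ^+ n).
Proof.
by case: n => // n ma _; rewrite exprS; apply/maxidealM/placeX/maxideal_place.
Qed.

(** One of [a / b] and [b / a] lies in [O], so the sum is an [O]-multiple of one of the summands. *)
Lemma maxidealD a b : maxideal O a -> maxideal O b -> maxideal O (a + b).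
Proof.
wlog: a b / (b != 0) && (a / b \in O).
  move=> H ma mb; have [->|a0] := eqVneq a 0; first by rewrite add0r.
  have [b0|b0] := eqVneq b 0; first by rewrite b0 addr0.
  have [Oab|nOab] := boolP (a / b \in O); first by apply: H; rewrite ?b0.
  by rewrite addrC; apply: H; rewrite // a0 -invf_div placeV.
move=> /andP[b0 Oab] _ mb.
have -> : a + b = b * (a / b + 1) by rewrite mulrDr mulr1 mulrC divfK.
by apply: maxidealM; rewrite ?placeD ?place1.
Qed.

Lemma unitD_max u a : unit_in O u -> maxideal O a -> unit_in O (u + a).
Proof.
move=> uu ma.
have [mua|//] := maxideal_unit (placeD (unit_place uu) (maxideal_place ma)).
case: (maxideal_nunit uu).
have -> : u = u + a + a * (-1) by rewrite mulrN1 addrK.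
by apply/maxidealD/maxidealM; rewrite ?placeN ?place1.
Qed.

Lemma maxideal0 : maxideal O 0.
Proof. by apply/maxidealE; split; [exact: place0 | left]. Qed.

Lemma maxideal_sum (I : Type) (s : seq I) (Q : pred I) (G : I -> F) :
  (forall i, Q i -> maxideal O (G i)) -> maxideal O (\sum_(i <- s | Q i) G i).
Proof.
by move=> OG; apply: (big_ind (maxideal O)) => //; [exact: maxideal0 | exact: maxidealD].
Qed.

(** Modulo the maximal ideal, [p(x)] is congruent to the nonzero constant [p.[b]]. *)
Lemma unit_horner (p : {poly K}) (x : F) b :
  maxideal O (x - iota b) -> ~~ root p b -> unit_in O (map_poly iota p).[x].
Proof.
move=> mx; rewrite rootE => pb.
have Ox : x \in O.
  by rewrite -[x](subrK (iota b)) placeD ?place_const ?(maxideal_place mx).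
have /factor_theorem[q Eq] : root (p - p.[b]%:P) b.
  by rewrite rootE !hornerE subrr.
have -> : p = p.[b]%:P + q * ('X - b%:P) by rewrite -Eq; ring.
rewrite rmorphD rmorphM rmorphB /= !map_polyC map_polyX !hornerE /=.
apply: unitD_max; first exact: unit_const.
by rewrite mulrC; apply: maxidealM => //; apply: place_horner.
Qed.

(** [ord] brings its own uniformizer; two uniformizers divide each other, so they differ by a unit
    that can be absorbed into [u]. *)
Lemma ord_uniformizer (pi z : F) (n : int) :
  uniformizer O pi -> pi != 0 -> ord O z n ->
  exists2 u, unit_in O u & z = pi ^ n * u.
Proof.
move=> [mpi divpi] pi0 [t [u [[mt divt] uu ->]]].
have [v Ov Et] := divpi _ mt; have [w Ow Epi] := divt _ mpi.
have vw1 : v * w = 1.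
  by apply: (mulfI pi0); rewrite mulr1 {2}Epi Et -mulrA.
have v0 : v != 0 by apply: contra_eq_neq vw1 => ->; rewrite mul0r eq_sym oner_neq0.
have uv : unit_in O v.
  by split => //; rewrite -(mulKf v0 w) vw1 mulr1 in Ow.
exists (v ^ n * u); last by rewrite Et expfzMl mulrA.
apply: unitM => //; case: n => n; first exact: unitX.
by rewrite NegzE -exprnN; apply/unitV/unitX.
Qed.

(** Makes the order well defined: different exponents would turn a unit into a multiple of a
    positive power of [pi]. *)
Lemma unit_expz_eq (pi u v : F) (n k : int) :
  maxideal O pi -> pi != 0 -> unit_in O u -> unit_in O v ->
  pi ^ n * u = pi ^ k * v -> n = k.
Proof.
move=> mpi pi0 uu uv.
wlog le_kn : n k u v uu uv / (k <= n)%R.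
  move=> H E; have [/H|/ltW/H] := leP k n; first by apply; [exact: uu|exact: uv|].
  by move=> /(_ v u uv uu (esym E)) ->.
move=> E; apply/eqP; apply: contraT => nk.
have [d Ed] : exists d, n = k + d.+1%:Z.
  exists (absz (n - k - 1)%R); have := le_kn; move: nk; lia.
move: E; rewrite Ed expfzDr // -mulrA => /(mulfI (expfz_neq0 _ pi0)) E.
case: (maxideal_nunit uv); rewrite -E; apply: maxidealM; last exact: unit_place.
by rewrite -exprnP; apply: maxidealX.
Qed.

End Place.

(** * Existence of places *)

Section SubringExtension.
Variable F : fieldType.

Definition subring_set (A : set F) : Prop :=
  A 1 /\ forall a b, A a -> A b -> [/\ A (a + b), A (a * b) & A (- a)].

Definition coefs_in (A : set F) (p : {poly F}) : Prop := forall i, A p`_i.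

Definition adjoin (A : set F) (z : F) : set F :=
  fun w => exists2 p, coefs_in A p & w = p.[z].

Section Closure.
Variable A : set F.
Hypothesis ringA : subring_set A.

Lemma subring_set1 : A 1. Proof. by case: ringA. Qed.
Lemma subring_setD a b : A a -> A b -> A (a + b).
Proof. by case: ringA => _ H Aa Ab; case: (H a b Aa Ab). Qed.
Lemma subring_setM a b : A a -> A b -> A (a * b).
Proof. by case: ringA => _ H Aa Ab; case: (H a b Aa Ab). Qed.
Lemma subring_setN a : A a -> A (- a).
Proof. by case: ringA => _ H Aa; case: (H a a Aa Aa). Qed.
Lemma subring_set0 : A 0.
Proof.
rewrite -(subrr 1).
by apply: subring_setD; [|apply: subring_setN]; exact: subring_set1.
Qed.
Lemma subring_set_sum (I : Type) (s : seq I) (Q : pred I) (G : I -> F) :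
  (forall i, A (G i)) -> A (\sum_(i <- s | Q i) G i).
Proof.
by move=> AG; apply: (big_ind A) => //; [exact: subring_set0 | exact: subring_setD].
Qed.

Lemma coefs_inD p q : coefs_in A p -> coefs_in A q -> coefs_in A (p + q).
Proof. by move=> Ap Aq i; rewrite coefD; apply: subring_setD. Qed.
Lemma coefs_inN p : coefs_in A p -> coefs_in A (- p).
Proof. by move=> Ap i; rewrite coefN; apply: subring_setN. Qed.
Lemma coefs_inM p q : coefs_in A p -> coefs_in A q -> coefs_in A (p * q).
Proof.
by move=> Ap Aq i; rewrite coefM; apply: subring_set_sum => j; apply: subring_setM.
Qed.
Lemma coefs_inC a : A a -> coefs_in A a%:P.
Proof. by move=> Aa i; rewrite coefC; case: ifP => // _; exact: subring_set0. Qed.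
Lemma coefs_inXn n : coefs_in A 'X^n.
Proof.
move=> i; rewrite coefXn.
by case: eqP => _; [exact: subring_set1 | exact: subring_set0].
Qed.
Lemma coefs_in_poly n (E : nat -> F) :
  (forall i, A (E i)) -> coefs_in A (\poly_(i < n) E i).
Proof. by move=> AE i; rewrite coef_poly; case: ifP => // _; exact: subring_set0. Qed.

Lemma adjoin_ring z : subring_set (adjoin A z).
Proof.
split.
  exists 1%:P; last by rewrite hornerC.
  by apply: coefs_inC; exact: subring_set1.
move=> _ _ [p Ap ->] [q Aq ->]; split.
- by exists (p + q); rewrite ?hornerD //; apply: coefs_inD.
- by exists (p * q); rewrite ?hornerM //; apply: coefs_inM.
- by exists (- p); rewrite ?hornerN //; apply: coefs_inN.
Qed.

Lemma adjoin_sub z a : A a -> adjoin A z a.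
Proof. by exists a%:P; rewrite ?hornerC //; apply: coefs_inC. Qed.

Lemma adjoin_gen z : adjoin A z z.
Proof. by exists 'X^1; [exact: coefs_inXn | rewrite hornerX]. Qed.

End Closure.

Section Maximal.
Variables (A : set F) (t : F).
Hypotheses (ringA : subring_set A) (At : A t) (t0 : t != 0) (AtV : ~ A t^-1).
Hypothesis maxA : forall z, ~ A z -> adjoin A z t^-1.

(** If [u = 1 - t b] were not invertible in [A], maximality would give [t^-1 = p(u^-1)] with
    coefficients in [A]. Multiplying by [u ^+ n = 1 - t c] clears the denominators and puts [t^-1]
    into [A]. *)
Lemma maximal_unit b : A b -> A (1 - t * b)^-1.
Proof.
move=> Ab; apply: contrapT => /maxA[p Ap Ep].
set u := 1 - t * b in Ep.
have u0 : u != 0.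
  apply/eqP => /eqP; rewrite subr_eq0 => /eqP E; apply: AtV.
  by rewrite -[t^-1]mulr1 E mulKf.
have Au n : exists2 c, A c & u ^+ n = 1 - t * c.
  elim: n => [|n [c Ac Ec]]; first by exists 0; [exact: subring_set0|rewrite expr0; ring].
  exists (c + b - t * b * c); last by rewrite exprS Ec /u; ring.
  apply: (subring_setD ringA); first exact: (subring_setD ringA).
  by apply: (subring_setN ringA); do 2!apply: (subring_setM ringA) => //.
have [c Ac Ec] := Au (size p).
have Ad : A (u ^+ size p * p.[u^-1]).
  rewrite horner_coef big_distrr /=; apply: (subring_set_sum ringA) => i.
  have -> : u ^+ size p * (p`_i * u^-1 ^+ i) = p`_i * u ^+ (size p - i).
    rewrite -{1}(subnK (ltnW (ltn_ord i))) exprD exprVn.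
    by field; rewrite expf_neq0.
  have [d Ad ->] := Au (size p - i)%N.
  apply: (subring_setM ringA) => //.
  apply: (subring_setD ringA); first exact: subring_set1.
  by apply: (subring_setN ringA); apply: (subring_setM ringA).
apply: AtV; have -> : t^-1 = u ^+ size p * p.[u^-1] + c.
  by rewrite -Ep Ec; field; rewrite t0.
exact: (subring_setD ringA).
Qed.

(* Among the relations [t p(z) = 1] and [t q(1/z) = 1] the longer one can
   always be shortened, by means of the shorter one. *)
Lemma maximal_valuation_step n (p q : {poly F}) z :
  z != 0 -> coefs_in A p -> coefs_in A q -> (size p + size q <= n)%N ->
  t * p.[z] = 1 -> t * q.[z^-1] = 1 -> False.
Proof.
elim: n p q z => [|n IHn] p q z z0 Ap Aq.
  rewrite leqn0 addn_eq0 size_poly_eq0 => /andP[/eqP-> _].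
  by rewrite horner0 mulr0 => /eqP; rewrite eq_sym oner_eq0.
(* The two relations are exchanged by replacing [z] with [z^-1]. *)
wlog le_qp : p q z z0 Ap Aq / (size q <= size p)%N.
  move=> H lepq Ep Eq; have [le|/ltnW le] := leqP (size q) (size p).
    exact: (H p q z).
  by apply: (H q p z^-1); rewrite ?invr_eq0 ?invrK // addnC.
move=> lepq Ep Eq.
set l := size q in le_qp lepq; set k := size p in le_qp lepq.
have l0 : (0 < l)%N.
  rewrite lt0n size_poly_eq0; apply: contra_eq_neq Eq => ->.
  by rewrite horner0 mulr0 eq_sym oner_neq0.
set v := (1 - t * q`_0)^-1.
have Av : A v by apply: maximal_unit.
have v0 : 1 - t * q`_0 != 0.
  apply/eqP => /eqP; rewrite subr_eq0 => /eqP E; apply: AtV.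
  by rewrite -[t^-1]mulr1 E mulKf.
(* Multiplying [t q(1/z) = 1] by [z ^+ l.-1] and dividing by the unit [1 - t q_0] expresses
   [z ^+ l.-1] through lower powers of [z]. *)
pose s := \poly_(i < l.-1) (t * v * q`_(l.-1 - i)).
have Es : z ^+ l.-1 = s.[z].
  rewrite horner_poly.
  have : 1 - t * q`_0 = \sum_(i < l.-1) t * q`_i.+1 * z^-1 ^+ i.+1.
    rewrite -Eq horner_coef -/l -(prednK l0) big_ord_recl /= expr0 mulr1 mulrDr.
    rewrite addrC addKr big_distrr /=; apply: eq_bigr => i _.
    by rewrite mulrA.
  move/(congr1 (fun w => v * w * z ^+ l.-1)).
  rewrite {1}/v mulVf // mul1r => ->.
  rewrite big_distrr big_distrl (reindex_inj rev_ord_inj) /=.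
  apply: eq_bigr => i _; have li := ltn_ord i.
  have -> : (l.-1 - i.+1).+1 = (l.-1 - i)%N by lia.
  have -> : z ^+ l.-1 = z ^+ i * z ^+ (l.-1 - i) by rewrite -exprD subnKC // ltnW.
  rewrite exprVn.
  by field; rewrite expf_neq0.
(* The leading power [z ^+ k.-1] of [p] is rewritten as [z ^+ (k - l) * s(z)], which lowers the size
   without changing the value at [z]. *)
pose p' := \poly_(i < k.-1) p`_i + (p`_k.-1)%:P * 'X^(k - l) * s.
apply: (IHn p' q z) => //.
- apply: (coefs_inD ringA); first exact: (coefs_in_poly ringA).
  apply: (coefs_inM ringA).
    by apply: (coefs_inM ringA); [exact: (coefs_inC ringA)|exact: (coefs_inXn ringA)].
  apply: (coefs_in_poly ringA) => i; apply: (subring_setM ringA) => //.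
  exact: (subring_setM ringA).
- suff : (size p' <= k.-1)%N by move: lepq l0 le_qp; rewrite -/l; lia.
  rewrite (leq_trans (size_polyD _ _)) // geq_max size_poly /=.
  rewrite -mulrA mul_polyC (leq_trans (size_scale_leq _ _)) //.
  have [->|s0] := eqVneq s 0; first by rewrite mulr0 size_poly0.
  rewrite mulrC size_mulXn //.
  have := size_poly l.-1 (fun i => t * v * q`_(l.-1 - i)); rewrite -/s.
  move: l0 le_qp; lia.
- rewrite -Ep; congr (_ * _).
  rewrite !hornerE -Es horner_poly [in RHS]horner_coef -/k.
  have k0 : (0 < k)%N by apply: leq_trans le_qp.
  rewrite -[in RHS](prednK k0) big_ord_recr /=; congr (_ + _).
  rewrite -mulrA -exprD; congr (_ * _ ^+ _); move: l0 le_qp; lia.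
Qed.

Lemma maximal_valuation z : ~ A z -> A z^-1.
Proof.
move=> nAz; apply: contrapT => nAzV.
have z0 : z != 0.
  by apply/eqP => z0; apply: nAz; rewrite z0; exact: (subring_set0 ringA).
have [p Ap Ep] := maxA nAz; have [q Aq Eq] := maxA nAzV.
by apply: (@maximal_valuation_step _ p q z _ Ap Aq (leqnn _)); rewrite -?Ep -?Eq ?divff.
Qed.

End Maximal.
End SubringExtension.

Local Open Scope classical_set_scope.
Local Open Scope ring_scope.

Lemma exists_place_maxideal (K F : fieldType) (iota : {rmorphism K -> F}) (t : F) :
  (forall p : {poly K}, (map_poly iota p).[t] = 0 -> p = 0) ->
  exists2 O : pred F, is_place iota O & maxideal O t.
Proof.
move=> trt.
have t0 : t != 0.
  apply/eqP => E; have := trt 'X; rewrite map_polyX hornerX => /(_ E)/eqP.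
  by rewrite polyX_eq0.
pose good (A : set F) :=
  [/\ subring_set A, forall c, A (iota c), A t & ~ A t^-1].
(* The ring [K[t]] starts the argument; it misses [t^-1] because [t] is transcendental over [K]. *)
pose A0 : set F := fun w => exists p : {poly K}, w = (map_poly iota p).[t].
have goodA0 : good A0.
  split.
  - split; first by exists 1; rewrite rmorph1 hornerC.
    move=> _ _ [p ->] [q ->]; split.
    + by exists (p + q); rewrite rmorphD hornerD.
    + by exists (p * q); rewrite rmorphM hornerM.
    + by exists (- p); rewrite rmorphN hornerN.
  - by move=> c; exists c%:P; rewrite map_polyC hornerC.
  - by exists 'X; rewrite map_polyX hornerX.
  - case=> p Ep; have := trt (1 - 'X * p).
    rewrite rmorphB rmorphM /= rmorph1 map_polyX !hornerE -Ep divff // subrr.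
    move=> /(_ erefl)/eqP; rewrite subr_eq0 => /eqP E.
    have := size_poly1 K; rewrite E => S1.
    have [p0|p0] := eqVneq p 0; first by move: S1; rewrite p0 mulr0 size_poly0.
    by move: S1; rewrite mulrC size_mulX // => -[/eqP]; rewrite size_poly_eq0 (negPf p0).
(* Zorn's lemma for unions also covers the empty chain, whose union is empty; hence goodness is
   required of nonempty sets only. *)
have [A [goodA maxA]] : exists A : set F, (A !=set0 -> good A) /\
    forall B, A `<` B -> ~ (B !=set0 -> good B).
  apply: Zorn_bigcup => C CP Ctot [w [A1 CA1 A1w]].
  have gC A : C A -> A !=set0 -> good A by exact: CP.
  have [r1 K1 t1 _] := gC _ CA1 (ex_intro _ w A1w).
  split.
  - split; first by exists A1 => //; case: r1.
    move=> a b [A CA Aa] [B CB Bb].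
    have [D [CD Da Db]] : exists D, [/\ C D, D a & D b].
      by have [AB|BA] := Ctot _ _ CA CB; [exists B|exists A]; split; auto.
    have [rD _ _ _] := gC _ CD (ex_intro _ a Da).
    by case: rD => _ /(_ a b Da Db)[? ? ?]; split; exists D.
  - by move=> c; exists A1.
  - by exists A1.
  - case=> A CA AtV; have [_ _ _] := gC _ CA (ex_intro _ _ AtV); exact.
(* The empty set has the weakened property, but it is not maximal, since [A0] strictly contains
   it. *)
have neA : A !=set0.
  apply: contrapT => neA; apply: (maxA A0); last by [].
  split; first by move=> w Aw; case: neA; exists w.
  by move=> sub; apply: neA; exists t; apply: sub; case: goodA0.
have [ringA constA At AtV] := goodA neA.
have maxA' z : ~ A z -> adjoin A z t^-1.
  move=> nAz; apply: contrapT => nt; apply: (maxA (adjoin A z)).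
    split; first by move=> w; exact: adjoin_sub.
    by move=> sub; apply/nAz/sub/adjoin_gen.
  move=> _; split => //; first exact: adjoin_ring.
  - by move=> c; apply: adjoin_sub.
  - exact: adjoin_sub.
exists (fun w => `[< A w >]).
  split; first by move=> c; apply/asboolP.
  split.
    move=> a b /asboolP Aa /asboolP Ab; have [_ /(_ a b Aa Ab)[? ? ?]] := ringA.
    by split; apply/asboolP.
  split; first by exists t^-1; apply/asboolP.
  move=> z; have [Az|nAz] := EM (A z); first by left; apply/asboolP.
  by right; apply/asboolP; exact: (maximal_valuation ringA At t0 AtV maxA').
split; first exact/asboolP.
by case=> _ _ /asboolP.
Qed.

(** * The Kummer extension and its place above [alpha] *)

Lemma mup_factor (K : fieldType) (b : K) (p : {poly K}) : p != 0 ->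
  exists2 q, ~~ root q b & p = q * ('X - b%:P) ^+ mup b p.
Proof.
move=> p0; have [n [q rq Ep]] := multiplicity_XsubC p b.
rewrite p0 /= in rq; exists q => //.
by rewrite {2}Ep mupMr // mup_XsubCX eqxx.
Qed.

(** If [m] does not divide [k], multiplication by [zeta ^+ k - 1 != 0] telescopes the geometric sum
    to [0]. *)
Lemma prim_root_sum (K : fieldType) m (zeta : K) k : m.-primitive_root zeta ->
  \sum_(j < m) zeta ^+ (j * k) = if (m %| k)%N then m%:R else 0.
Proof.
move=> prim; under eq_bigr do rewrite mulnC exprM.
rewrite (prim_order_dvd prim); case: eqP => [->|/eqP zk1].
  by under eq_bigr do rewrite expr1n; rewrite sumr_const card_ord.
apply: (mulfI (_ : zeta ^+ k - 1 != 0)); first by rewrite subr_eq0.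
by rewrite -subrX1 -exprM mulnC exprM (prim_expr_order prim) expr1n subrr mulr0.
Qed.

(** * Polynomials in [x] at finite and infinite places *)

Section RationalFunctions.
Variables (K F : fieldType) (iota : {rmorphism K -> F}) (x : F).
Hypothesis trx : forall p : {poly K}, (map_poly iota p).[x] = 0 -> p = 0.

Definition evalx : {poly K} -> F := horner_eval x \o map_poly iota.
HB.instance Definition _ := GRing.RMorphism.on evalx.

Lemma evalxE p : evalx p = (map_poly iota p).[x]. Proof. by []. Qed.

Lemma evalx_eq0 p : (evalx p == 0) = (p == 0).
Proof. by apply/eqP/eqP => [/trx//|->]; rewrite rmorph0. Qed.

Lemma evalxC c : evalx c%:P = iota c.
Proof. by rewrite evalxE map_polyC hornerC. Qed.

Lemma evalx_XsubC b : evalx ('X - b%:P) = x - iota b.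
Proof. by rewrite rmorphB /= evalxC evalxE map_polyX hornerX. Qed.

Lemma subx_neq0 b : x - iota b != 0.
Proof. by rewrite -evalx_XsubC evalx_eq0 polyXsubC_eq0. Qed.

Section FinitePlace.
Variables (O : pred F) (b : K).
Hypotheses (placeO : is_place iota O) (mb : maxideal O (x - iota b)).

Lemma evalx_mup (p : {poly K}) : p != 0 ->
  exists2 u, unit_in O u & evalx p = (x - iota b) ^+ mup b p * u.
Proof.
move=> p0; have [q rq Ep] := mup_factor b p0.
exists (evalx q); first exact: (unit_horner placeO mb).
by rewrite {1}Ep rmorphM rmorphXn /= evalx_XsubC mulrC.
Qed.

Lemma mup_le_place (p q : {poly K}) : p != 0 -> q != 0 ->
  evalx p / evalx q \in O -> (mup b q <= mup b p)%N.
Proof.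
move=> p0 q0 Opq; rewrite leqNgt; apply/negP => lt_pq.
have [u uu Ep] := evalx_mup p0; have [v uv Eq] := evalx_mup q0.
have [d Ed] : exists d, mup b q = (mup b p + d.+1)%N.
  by exists (mup b q - mup b p).-1; lia.
set t := x - iota b in Ep Eq.
have t0 : t != 0 by exact: subx_neq0.
have /negP := maxideal_notin (expf_neq0 d.+1 t0) (maxidealX placeO mb (ltn0Sn d)).
apply; have [u0 _ OuV] := uu; have [v0 Ov _] := uv.
have -> : (t ^+ d.+1)^-1 = evalx p / evalx q * (v / u).
  by rewrite Ep Eq Ed exprD; field; rewrite u0 v0 !expf_neq0.
by apply: (placeM placeO) => //; apply: (placeM placeO).
Qed.

End FinitePlace.

Section InfinitePlace.
Variable O : pred F.
Hypotheses (placeO : is_place iota O) (nOx : x \notin O).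

Let x0 : x != 0. Proof. by apply: contraNneq nOx => ->; rewrite (place0 placeO). Qed.

(** Since [x^-1] lies in the maximal ideal, division by the top power of [x] leaves the leading
    coefficient plus an element of that ideal. *)
Lemma evalx_degree (p : {poly K}) : p != 0 ->
  exists2 u, unit_in O u & evalx p = x ^+ (size p).-1 * u.
Proof.
move=> p0; set n := (size p).-1.
have szp : size p = n.+1 by rewrite prednK // size_poly_gt0.
have mx := maxidealV placeO nOx.
exists (iota (lead_coef p) + \sum_(i < n) x^-1 ^+ (n - i) * iota p`_i).
  apply: (unitD_max placeO); first by apply: (unit_const placeO); rewrite lead_coef_eq0.
  apply: (maxideal_sum placeO) => i _; apply: (maxidealM placeO).
    by apply: (maxidealX placeO) => //; rewrite subn_gt0.
  exact: (place_const placeO).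
rewrite evalxE horner_coef size_map_poly szp big_ord_recr /= coef_map addrC mulrDr.
rewrite [_ * iota _]mulrC lead_coefE -/n; congr (_ + _).
rewrite big_distrr; apply: eq_bigr => i _ /=; rewrite coef_map mulrC mulrA.
congr (_ * _); have le_in := ltnW (ltn_ord i).
have -> : x ^+ i = x ^+ (n - (n - i)) by rewrite subKn.
by rewrite exprVn -exprB ?unitfE ?leq_subr.
Qed.

Lemma size_le_place (p q : {poly K}) : p != 0 -> q != 0 ->
  (evalx p / evalx q \in O) = (size p <= size q)%N.
Proof.
move=> p0 q0; have [u uu Ep] := evalx_degree p0; have [v uv Eq] := evalx_degree q0.
have := size_poly_gt0 p; have := size_poly_gt0 q; rewrite p0 q0 => sq sp.
have [u0 Ou OuV] := uu; have [v0 Ov OvV] := uv.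
apply/idP/idP => [Opq|le_pq].
  rewrite leqNgt; apply/negP => lt_qp.
  have [d Ed] : exists d, (size p).-1 = ((size q).-1 + d.+1)%N.
    by exists (size p - size q).-1; move: sp sq lt_qp; clear; lia.
  case/negP: nOx; apply: (place_root placeO (ltn0Sn d)).
  have -> : x ^+ d.+1 = evalx p / evalx q * (v / u).
    by rewrite Ep Eq Ed exprD; field; rewrite u0 v0 !expf_neq0.
  by apply: (placeM placeO) => //; apply: (placeM placeO).
have [d Ed] : exists d, (size q).-1 = ((size p).-1 + d)%N.
  by exists (size q - size p)%N; move: sp sq le_pq; clear; lia.
have -> : evalx p / evalx q = x^-1 ^+ d * (u / v).
  by rewrite Ep Eq Ed exprD exprVn; field; rewrite v0 !expf_neq0.
apply: (placeM placeO); last exact: (placeM placeO).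
by apply: (placeX placeO); apply: (placeV placeO).
Qed.

End InfinitePlace.

End RationalFunctions.

(** * The structure of [F] over [K(x)], seen from [alpha] *)

Section RootPlace.
Variables (K : fieldType) (m : nat) (f : {poly K}).
Variables (F : fieldType) (iota : {rmorphism K -> F}) (x y : F) (alpha : K).
Hypothesis m_gt0 : (0 < m)%N.
Hypothesis sepf : separable_poly f.
Hypothesis trx : forall p : {poly K}, (map_poly iota p).[x] = 0 -> p = 0.
Hypothesis ym : y ^+ m = (map_poly iota f).[x].
Hypothesis fa : root f alpha.

Notation ev := (evalx iota x).
(** The second coordinate is a parameter so that conjugates of [y] can be substituted as well. *)
Definition evalxy (w : F) : {poly {poly K}} -> F := horner_eval w \o map_poly ev.
HB.instance Definition _ w := GRing.RMorphism.on (evalxy w).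

Lemma evalxyE w (p : {poly {poly K}}) n : (size p <= n)%N ->
  evalxy w p = \sum_(i < n) ev p`_i * w ^+ i.
Proof.
move=> szp; rewrite /evalxy /= /horner_eval (@horner_coef_wide _ n).
  by apply: eq_bigr => i _; rewrite coef_map.
by rewrite (leq_trans _ szp) // size_poly.
Qed.

Lemma eval2E (p : {poly {poly K}}) : eval2 iota x y p = evalxy y p.
Proof. by rewrite (evalxyE y (leqnn (size p))). Qed.

Lemma evalxyC w (p : {poly K}) : evalxy w p%:P = ev p.
Proof. by rewrite /evalxy /= /horner_eval map_polyC hornerC. Qed.

Lemma evalxyX w : evalxy w 'X = w.
Proof. by rewrite /evalxy /= /horner_eval map_polyX hornerX. Qed.

Let f0 := separable_poly_neq0 sepf.

Lemma mup_separable b : (mup b f <= 1)%N.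
Proof.
rewrite leqNgt mup_geq //; apply/negP => dvd2.
have /separable_polyP[/(_ ('X - b%:P) ('X - b%:P))] := sepf.
rewrite -expr2 => /(_ dvd2).
by rewrite coprimepp size_XsubC.
Qed.

(** Separability makes [alpha] a simple root of [f]. *)
Lemma ym_cofactor :
  exists2 g, ~~ root g alpha & y ^+ m = (x - iota alpha) * ev g.
Proof.
have [g rg Ef] := mup_factor alpha f0; exists g => //.
rewrite ym -[LHS]/(ev f) -evalx_XsubC -rmorphM; congr (ev _).
rewrite {1}Ef mulrC; congr (_ * _).
have := mup_separable alpha; have : (0 < mup alpha f)%N.
  by rewrite -XsubC_dvd // dvdp_XsubCl.
by case: (mup alpha f) => [|[|]].
Qed.

Lemma y_neq0 : y != 0.
Proof.
apply: contra_eq_neq ym => ->; rewrite expr0n gtn_eqF // eq_sym.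
by rewrite -/(ev f) evalx_eq0 //.
Qed.

Section AtAlpha.
Variable O : pred F.
Hypotheses (placeO : is_place iota O) (ma : maxideal O (x - iota alpha)).

Lemma maxideal_y : maxideal O y.
Proof.
have mym : maxideal O (y ^+ m).
  have [g _ ->] := ym_cofactor; apply: (maxidealM placeO) => //.
  apply: (place_horner placeO).
  rewrite -[x](subrK (iota alpha)) (placeD placeO) ?(place_const placeO) //.
  exact: maxideal_place ma.
have Oy := place_root placeO m_gt0 (maxideal_place mym).
by have [//|/(unitX placeO m)/maxideal_nunit] := maxideal_unit placeO Oy.
Qed.

Lemma evalx_y (p : {poly K}) : p != 0 ->
  exists2 u, unit_in O u & ev p = y ^+ (m * mup alpha p) * u.
Proof.
move=> p0; have [u uu Ep] := evalx_mup placeO ma p0.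
have [g rg Eg] := ym_cofactor.
have ug : unit_in O (ev g) by exact: (unit_horner placeO ma).
exists (u / ev g ^+ mup alpha p).
  by apply: (unitM placeO) => //; apply: unitV; apply: (unitX placeO).
rewrite Ep exprM Eg exprMn -mulrA; congr (_ * _).
by rewrite mulrCA divff ?mulr1 // expf_neq0 // (unit_neq0 ug).
Qed.

End AtAlpha.

(* The terms [q_k(x) y^k] have distinct orders modulo [m] at a place above
   [alpha], hence the order of the sum is their minimum. *)
Lemma evalxy_order (q : {poly {poly K}}) : (size q <= m)%N -> q != 0 ->
  exists k, [/\ (k < m)%N, q`_k != 0 &
    forall O, is_place iota O -> maxideal O (x - iota alpha) ->
      exists2 u, unit_in O u & evalxy y q = y ^+ (k + m * mup alpha q`_k) * u].
Proof.
move=> szq q0.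
have ltm : ((size q).-1 < m)%N by rewrite prednK // size_poly_gt0.
pose i0 := Ordinal ltm.
have nzi0 : q`_i0 != 0 by rewrite -lead_coefE lead_coef_eq0.
pose M (i : 'I_m) := (i + m * mup alpha q`_i)%N.
(* The index [k] of least order depends on [q] alone and not on [O]; this uniformity is what later
   identifies all places above [alpha]. *)
have [k nzk mink] := @arg_minnP _ i0 (fun i : 'I_m => q`_i != 0) M nzi0.
exists k; split => // O placeO ma.
have my := maxideal_y placeO ma; have y0 := y_neq0.
have [u uu Ek] := evalx_y placeO ma nzk.
exists (u + \sum_(i < m | i != k) ev q`_i * y ^+ i / y ^+ M k).
  apply: (unitD_max placeO) => //; apply: (maxideal_sum placeO) => i ik.
  have [->|nzi] := eqVneq q`_i 0.
    by rewrite rmorph0 !mul0r; exact: (maxideal0 placeO).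
  have [v uv ->] := evalx_y placeO ma nzi.
  have lt_ki : (M k < M i)%N.
    rewrite ltn_neqAle mink // andbT; apply: contra_neq ik => E.
    apply: val_inj; rewrite /= -(modn_small (ltn_ord i)) -(modn_small (ltn_ord k)).
    move/(congr1 (modn^~ m)): E; rewrite /M.
    by rewrite ![(m * _)%N]mulnC ![(_ + _ * m)%N]addnC !modnMDl.
  have -> : y ^+ (m * mup alpha q`_i) * v * y ^+ i / y ^+ M k = y ^+ (M i - M k) * v.
    have E : y ^+ (m * mup alpha q`_i) * y ^+ i = y ^+ (M i - M k) * y ^+ M k.
      by rewrite -!exprD subnK ?(ltnW lt_ki) // addnC.
    by rewrite [_ * v * _]mulrAC E mulrAC mulfK ?expf_neq0.
  apply: (maxidealM placeO); last exact: unit_place uv.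
  by apply: (maxidealX placeO) => //; rewrite subn_gt0.
rewrite (evalxyE y szq) (bigD1 k) //= Ek mulrDr -/(M k); congr (_ + _).
  by rewrite mulrAC -exprD addnC.
by rewrite big_distrr; apply: eq_bigr => i _ /=; rewrite mulrCA divff ?mulr1 ?expf_neq0.
Qed.

Variable P : pred F.
Hypotheses (placeP : is_place iota P) (maP : maxideal P (x - iota alpha)).

(** This is the independence of [1, y, ..., y^(m-1)] over [K(x)]: at [P] the value is a power of [y]
    times a unit. *)
Lemma evalxy_neq0 (q : {poly {poly K}}) :
  (size q <= m)%N -> q != 0 -> evalxy y q != 0.
Proof.
move=> szq q0; have [k [_ _ /(_ P placeP maP)[u uu ->]]] := evalxy_order szq q0.
by rewrite mulf_neq0 ?expf_neq0 ?y_neq0 ?(unit_neq0 uu).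
Qed.

Definition kummer_poly : {poly {poly K}} := 'X^m - f%:P.

Lemma size_kummer_poly : size kummer_poly = m.+1.
Proof. by rewrite size_XnsubC. Qed.

Lemma evalxy_kummer_poly w : w ^+ m = ev f -> evalxy w kummer_poly = 0.
Proof. by move=> wm; rewrite rmorphB rmorphXn /= evalxyX evalxyC wm subrr. Qed.

(** One remainder modulo [X^m - f] serves all roots [w] simultaneously. *)
Lemma evalxy_reduce q : exists2 q' : {poly {poly K}}, (size q' <= m)%N &
  forall w, w ^+ m = ev f -> evalxy w q = evalxy w q'.
Proof.
have mon : kummer_poly \is monic by exact: monicXnsubC.
exists (rmodp q kummer_poly).
  by rewrite -ltnS -size_kummer_poly ltn_rmodpN0 ?monic_neq0.
move=> w wm; rewrite {1}(rdivp_eq mon q) rmorphD rmorphM /=.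
by rewrite evalxy_kummer_poly // mulr0 add0r.
Qed.

Lemma evalxy_ker w q : w ^+ m = ev f -> evalxy y q = 0 -> evalxy w q = 0.
Proof.
move=> wm; have [q' szq' Eq] := evalxy_reduce q; rewrite !Eq //.
have [->|q0] := eqVneq q' 0; first by rewrite !rmorph0.
by move/eqP; rewrite (negPf (evalxy_neq0 szq' q0)).
Qed.

(** The resultant with [X^m - f] is a combination of both polynomials, so at [y] it becomes a
    multiple of the given value. *)
Lemma evalxy_inv q : evalxy y q != 0 ->
  exists (u : {poly {poly K}}) (d : {poly K}), d != 0 /\ evalxy y u * evalxy y q = ev d.
Proof.
have [q' szq' Eq] := evalxy_reduce q; rewrite {}Eq // => Eq0.
have q0 : q' != 0 by apply: contraNneq Eq0 => ->; rewrite rmorph0.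
(* Constants are treated separately, since the resultant identity asks for sizes above 1. *)
have [/size1_polyC Eq|szq] := leqP (size q') 1.
  exists 1, q'`_0; rewrite rmorph1 mul1r {2}Eq evalxyC; split => //.
  by move: q0; rewrite Eq polyC_eq0 -Eq.
have szk : (1 < size kummer_poly)%N by rewrite size_kummer_poly.
have [[u v] /= _ Euv] := resultant_in_ideal szq szk.
exists u, (resultant q' kummer_poly); split; last first.
  have /= := congr1 (evalxy y) Euv; rewrite evalxyC rmorphD !rmorphM /=.
  by rewrite evalxy_kummer_poly // mulr0 addr0.
(* A vanishing resultant would split [X^m - f], up to a scalar, into two factors of size at most
   [m]; neither vanishes at [y], yet their product does. *)
rewrite resultant_eq0 -leqNgt leqNgt; apply/negP => szg.
set g := gcdp q' kummer_poly in szg.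
have k0 : kummer_poly != 0 by rewrite -size_poly_gt0 size_kummer_poly.
have /Pdiv.Idomain.dvdpP[[c h] /= c0 Eh] := dvdp_gcdr q' kummer_poly.
have g0 : g != 0 by rewrite -size_poly_gt0 ltnW.
have h0 : h != 0.
  apply: contra_eq_neq Eh => ->; rewrite mul0r scale_poly_eq0 negb_or c0.
  by rewrite -size_poly_gt0 size_kummer_poly.
have szg' : (size g <= m)%N by rewrite (leq_trans (leq_gcdpl _ q0)).
have szh : (size h <= m)%N.
  have := size_mul h0 g0; rewrite -Eh size_scale // size_kummer_poly.
  by move: szg; clear; lia.
have /eqP := congr1 (evalxy y) Eh.
rewrite -mul_polyC !rmorphM /= evalxy_kummer_poly // mulr0 eq_sym mulf_eq0.
by rewrite (negPf (evalxy_neq0 szg' g0)) (negPf (evalxy_neq0 szh h0)).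
Qed.

Hypothesis genxy : forall z : F, exists p q : {poly {poly K}},
  eval2 iota x y q != 0 /\ z = eval2 iota x y p / eval2 iota x y q.

Lemma field_repr z : exists (q : {poly {poly K}}) (d : {poly K}),
  [/\ (size q <= m)%N, d != 0 & z = evalxy y q / ev d].
Proof.
have [p [q []]] := genxy z; rewrite !eval2E => q0 ->.
have [u [d [d0 Ed]]] := evalxy_inv q0.
have [q' szq' Eq'] := evalxy_reduce (p * u).
exists q', d; split => //; rewrite -Eq' // rmorphM /= -Ed.
have u0 : evalxy y u != 0.
  by apply: contra_eq_neq Ed => ->; rewrite mul0r eq_sym evalx_eq0.
by field; rewrite q0 u0.
Qed.

Lemma frac_order (q : {poly {poly K}}) (d : {poly K}) :
  (size q <= m)%N -> q != 0 -> d != 0 ->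
  exists k, [/\ (k < m)%N, q`_k != 0 &
    forall O, is_place iota O -> maxideal O (x - iota alpha) ->
      exists2 u, unit_in O u & evalxy y q / ev d =
        y ^ (k%:Z + (m * mup alpha q`_k)%:Z - (m * mup alpha d)%:Z) * u].
Proof.
move=> szq q0 d0; have [k [km qk0 Ek]] := evalxy_order szq q0.
exists k; split => // O placeO maO.
have [u uu ->] := Ek O placeO maO; have [v uv ->] := evalx_y placeO maO d0.
exists (u / v); first by apply: (unitM placeO) => //; apply: unitV.
by rewrite expfzDr ?y_neq0 // -PoszD -exprnP -exprnN mulf_div.
Qed.

Lemma order_at_alpha z : z != 0 -> exists n : int,
  forall O, is_place iota O -> maxideal O (x - iota alpha) ->
    exists2 u, unit_in O u & z = y ^ n * u.
Proof.
have [q [d [szq d0 ->]]] := field_repr z => z0.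
have q0 : q != 0 by apply: contraNneq z0 => ->; rewrite rmorph0 mul0r.
by have [k [_ _ Ek]] := frac_order szq q0 d0; eexists; exact: Ek.
Qed.

Lemma expz_place O n u : is_place iota O -> maxideal O (x - iota alpha) ->
  unit_in O u -> (y ^ n * u \in O) = (0 <= n).
Proof.
move=> placeO maO uu; have my := maxideal_y placeO maO.
have [u0 Ou OuV] := uu; case: n => n.
  by rewrite -exprnP (placeM placeO) // (placeX placeO) // (maxideal_place my).
rewrite NegzE -exprnN; apply/negbTE/negP => Oyu.
have := maxideal_notin (expf_neq0 n.+1 y_neq0) (maxidealX placeO my (ltn0Sn n)).
by rewrite -[_^-1](mulfK u0) (placeM placeO).
Qed.

Lemma uniformizer_y O : is_place iota O -> maxideal O (x - iota alpha) ->
  uniformizer O y.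
Proof.
move=> placeO maO; split; first exact: maxideal_y.
move=> w mw; have [->|w0] := eqVneq w 0.
  by exists 0; rewrite ?mulr0 //; exact: (place0 placeO).
have [n /(_ O placeO maO)[u uu Ew]] := order_at_alpha w0.
exists (y ^ (n - 1) * u); last first.
  have := expfzDr 1 (n - 1) y_neq0; rewrite addrC subrK => Ey.
  by rewrite {1}Ew Ey mulrA.
rewrite expz_place //; have := maxideal_notin w0 mw.
rewrite Ew invfM invr_expz expz_place //; last exact: unitV.
lia.
Qed.

(** Membership in either ring is decided by the sign of the same exponent [n], which
    [order_at_alpha] fixes before the place is chosen. *)
Lemma same_place_alpha O O' : is_place iota O -> maxideal O (x - iota alpha) ->
  is_place iota O' -> maxideal O' (x - iota alpha) -> same_place O O'.
Proof.
move=> placeO maO placeO' maO' w.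
have [->|w0] := eqVneq w 0; first by rewrite (place0 placeO) (place0 placeO').
have [n En] := order_at_alpha w0.
have [u uu {1}->] := En O placeO maO; have [v uv ->] := En O' placeO' maO'.
by rewrite !expz_place.
Qed.

(** Relations satisfied by [y] hold for [w] by [evalxy_ker], so sending a fraction in [y] to the
    same fraction in [w] is well defined. *)
Lemma kummer_morphism w : w ^+ m = ev f -> exists s : F -> F,
  [/\ {morph s : a b / a + b}, {morph s : a b / a * b} &
      forall q, s (evalxy y q) = evalxy w q].
Proof.
move=> wm.
(* A relation [u q = d] with [d != 0] in [K[x]] carries over to [w], so denominators stay
   nonzero. *)
have nz q : evalxy y q != 0 -> evalxy w q != 0.
  move=> /evalxy_inv[u [d [d0 Ed]]].
  have /eqP : evalxy y (u * q - d%:P) = 0.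
    by rewrite rmorphB rmorphM /= evalxyC Ed subrr.
  move/eqP/(evalxy_ker wm)/eqP; rewrite rmorphB rmorphM /= evalxyC subr_eq0.
  by apply: contraTneq => ->; rewrite mulr0 eq_sym evalx_eq0.
have /choice[nd Hnd] : forall z, exists nd : {poly {poly K}} * {poly {poly K}},
    evalxy y nd.2 != 0 /\ z = evalxy y nd.1 / evalxy y nd.2.
  by move=> z; have [p [q]] := genxy z; rewrite !eval2E; exists (p, q).
pose s z := evalxy w (nd z).1 / evalxy w (nd z).2.
have sE p q : evalxy y q != 0 ->
    s (evalxy y p / evalxy y q) = evalxy w p / evalxy w q.
  move=> q0; set z := evalxy y p / _; have [d0 Ez] := Hnd z; rewrite /s.
  apply/eqP; rewrite eqr_div ?nz // -!(rmorphM (evalxy w)) -subr_eq0 -rmorphB; apply/eqP.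
  apply: evalxy_ker => //; apply/eqP; rewrite rmorphB subr_eq0 !rmorphM /=.
  by rewrite -eqr_div // -Ez.
exists s; split=> [a b|a b|q].
- have [qa Ea] := Hnd a; have [qb Eb] := Hnd b; rewrite {1}Ea {1}Eb addf_div //.
  rewrite -!(rmorphM (evalxy y)) -(rmorphD (evalxy y)) sE ?rmorphM ?mulf_neq0 //.
  by rewrite /= rmorphD !rmorphM /= /s addf_div ?nz.
- have [qa Ea] := Hnd a; have [qb Eb] := Hnd b; rewrite {1}Ea {1}Eb mulf_div.
  by rewrite -!(rmorphM (evalxy y)) sE ?rmorphM ?mulf_neq0 //= /s mulf_div.
- by rewrite -[evalxy y q]divr1 -(rmorph1 (evalxy y)) sE rmorph1 ?oner_neq0 ?divr1.
Qed.

(** * Conjugates and components of a function regular away from [P] *)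

Section Conjugates.
Variables (Q : pred F) (h1 h2 : {poly K}) (q : {poly {poly K}}) (d : {poly K}).
Hypotheses (placeQ : is_place iota Q) (Qa : (x - iota alpha)^-1 \in Q).
Hypotheses (nQh : ev h1 / ev h2 \notin Q) (szq : (size q <= m)%N).
Hypothesis away : forall Q', is_place iota Q' -> ~ same_place Q' P ->
  evalxy y q / ev d \in Q'.

(** The preimage of [Q] under [y |-> w] is again a place. It differs from [P] because [x - alpha] is
    fixed and its inverse lies in [Q], so [away] applies to it. *)
Lemma conjugate_in_place w : w ^+ m = ev f -> evalxy w q / ev d \in Q.
Proof.
move=> wm; have [s [sD sM sE]] := kummer_morphism wm.
have sev p : s (ev p) = ev p by rewrite -(evalxyC y) sE !evalxyC.
have siota c : s (iota c) = iota c by rewrite -(evalxC iota x) sev.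
have s1 : s 1 = 1 by rewrite -(rmorph1 iota) siota.
have s0 : s 0 = 0 by rewrite -(rmorph0 iota) siota.
have sN a : s (- a) = - s a.
  by apply/eqP; rewrite -subr_eq0 opprK -sD addNr s0.
have sV a : s a^-1 = (s a)^-1.
  have [->|a0] := eqVneq a 0; first by rewrite invr0 s0 invr0.
  have E : s a * s a^-1 = 1 by rewrite -sM divff.
  have sa0 : s a != 0.
    by apply: contra_eq_neq E => ->; rewrite mul0r eq_sym oner_neq0.
  by rewrite -[LHS](mulKf sa0) E mulr1.
pose Q' : pred F := fun z => s z \in Q.
have Q'E z : (z \in Q') = (s z \in Q) by [].
have placeQ' : is_place iota Q'.
  split; first by move=> c; rewrite Q'E siota (place_const placeQ).
  split.
    move=> a b; rewrite !Q'E sD sM sN => Qa' Qb'.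
    by rewrite (placeD placeQ) // (placeM placeQ) // (placeN placeQ).
  (* The preimage is proper because [ev h1 / ev h2] is fixed by [s] and lies outside [Q]. *)
  split; first by exists (ev h1 / ev h2); rewrite Q'E sM sV !sev.
  move=> z; rewrite !Q'E sV; case E: (s z \in Q); first by left.
  by right; apply: (placeV placeQ); rewrite E.
have -> : evalxy w q / ev d = s (evalxy y q / ev d) by rewrite sM sV sE sev.
rewrite -Q'E; apply: away => // same.
have := maxideal_notin (subx_neq0 trx alpha) maP.
by rewrite -same Q'E sV -evalx_XsubC sev evalx_XsubC Qa.
Qed.

(* [m h_a(x) y^a] is the sum over [j < m] of [zeta^(- j a)] times the conjugate of
   [sum_k h_k(x) y^k] under [y |-> zeta^j y]. *)
Lemma component_in_place (zeta : K) a :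
  m.-primitive_root zeta -> (m%:R : K) != 0 ->
  (a < m)%N -> ev q`_a * y ^+ a / ev d \in Q.
Proof.
move=> prim m0 am; pose h k := ev q`_k * y ^+ k / ev d.
have conj j : (iota (zeta ^+ j) * y) ^+ m = ev f.
  rewrite exprMn -rmorphXn -exprM mulnC exprM (prim_expr_order prim).
  by rewrite expr1n rmorph1 mul1r.
(* The exponent [j * (m - a)] stands for [- j a] modulo [m]. *)
have avg : \sum_(j < m) iota (zeta ^+ (j * (m - a))) *
    (evalxy (iota (zeta ^+ j) * y) q / ev d) = iota m%:R * h a.
  have Ej (j : 'I_m) : iota (zeta ^+ (j * (m - a))) *
      (evalxy (iota (zeta ^+ j) * y) q / ev d) =
      \sum_(k < m) iota (zeta ^+ (j * (m - a + k))) * h k.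
    rewrite (evalxyE _ szq) big_distrl big_distrr; apply: eq_bigr => k _ /=.
    by rewrite /h exprMn -rmorphXn -exprM mulnDr exprD rmorphM /=; ring.
  rewrite (eq_bigr _ (fun j _ => Ej j)) exchange_big /=.
  rewrite (bigD1 (Ordinal am)) //= [X in _ + X]big1 ?addr0 => [|k ka].
    by rewrite -mulr_suml -rmorph_sum /= prim_root_sum // subnK ?(ltnW am) // dvdnn.
  rewrite -mulr_suml -rmorph_sum /= prim_root_sum //.
  suff /negPf-> : ~~ (m %| m - a + k)%N by rewrite rmorph0 mul0r.
  (* Since [0 < m - a + k < 2 m], divisibility by [m] leaves only [k = a]. *)
  apply: contra ka => dvd; apply/eqP/val_inj => /=.
  have km := ltn_ord k; have [c Ec] := dvdnP dvd; move: Ec am km; clear.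
  by case: c => [|[|c]]; rewrite ?mulSn; lia.
have -> : ev q`_a * y ^+ a / ev d = iota m%:R^-1 * (iota m%:R * h a).
  by rewrite mulrA -rmorphM mulVf // rmorph1 mul1r.
rewrite -avg; apply: (placeM placeQ); first exact: (place_const placeQ).
apply: (place_sum placeQ) => j _; apply: (placeM placeQ).
  exact: (place_const placeQ).
exact: conjugate_in_place.
Qed.

End Conjugates.

Lemma monomial_pole_divisor r a b s : size f = r.+1 -> (r * a <= m * b)%N ->
  (m * b = s + a)%N -> pole_divisor_is iota (y ^+ a / (x - iota alpha) ^+ b) P s.
Proof.
move=> szf le_ab Es; set t := x - iota alpha.
have t0 : t != 0 by exact: subx_neq0.
split.
  (* At [P], [y ^+ m = t g] with [g] a unit turns [y ^+ a / t ^+ b] into [y ^ (- s) * g ^+ b]. *)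
  have [g rg Eg] := ym_cofactor.
  exists y, (ev g ^+ b); split; first exact: uniformizer_y.
    by apply: (unitX placeP); exact: (unit_horner placeP maP).
  have g0 : ev g != 0 by rewrite evalx_eq0 //; apply: contraNneq rg => ->; rewrite root0.
  have tE : t ^+ b * ev g ^+ b = y ^+ s * y ^+ a by rewrite -exprMn -Eg -exprM Es exprD.
  rewrite -exprnN; apply: (canLR (mulfK (expf_neq0 b t0))).
  by rewrite -mulrA [_ * t ^+ b]mulrC tE mulKf // expf_neq0 ?y_neq0.
(* At a finite place other than [P], [y] is integral and [t] is a unit, by uniqueness of the place
   above [alpha]. *)
move=> Q placeQ nsame; have [Qx|nQx] := boolP (x \in Q).
  have Qt : t \in Q by rewrite (placeD placeQ) // (placeN placeQ) // (place_const placeQ).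
  have Qy : y \in Q by apply: (place_root placeQ m_gt0); rewrite ym (place_horner placeQ).
  have [mt|[_ _ QtV]] := maxideal_unit placeQ Qt.
    by case: nsame; exact: same_place_alpha.
  by rewrite (placeM placeQ) ?(placeX placeQ) // -exprVn (placeX placeQ).
(* At infinity, the [m]-th power is a rational function of [x], and [r a <= m b] compares the
   degrees. *)
apply: (place_root placeQ m_gt0).
have -> : (y ^+ a / t ^+ b) ^+ m = ev (f ^+ a) / ev (('X - alpha%:P) ^+ (b * m)).
  rewrite exprMn exprVn -exprM mulnC exprM ym -exprM !rmorphXn /=.
  by rewrite evalx_XsubC.
rewrite size_le_place ?expf_neq0 ?polyXsubC_eq0 // size_exp_XsubC.
have := size_exp f a; rewrite szf /= => szfa.
rewrite (leq_trans (leqSpred _)) // ltnS szfa; move: le_ab; clear; lia.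
Qed.

End RootPlace.

(** * Gaps *)

Lemma closed_prim_root_exists (K : closedFieldType) n :
  (n%:R : K) != 0 -> exists z : K, n.-primitive_root z.
Proof.
move=> n0; have n_gt0 : (0 < n)%N by case: n n0 => //; rewrite eqxx.
pose p : {poly K} := 'X^n - 1; have [r Dp] := closed_field_poly_normal p.
rewrite (monicP _) ?monicXnsubC // scale1r in Dp.
have rn1 : all n.-unity_root r by apply/allP=> z; rewrite -root_prod_XsubC -Dp.
have sz_r : (n < (size r).+1)%N by rewrite -(size_prod_XsubC r id) -Dp size_XnsubC.
have [|z] := hasP (has_prim_root n_gt0 rn1 _ sz_r); last by exists z.
by rewrite -separable_prod_XsubC -Dp separable_Xn_sub_1.
Qed.

(** Both polynomials split, so multiplicities count entries in the lists of roots, and one list is a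
    permuted sublist of the other. *)
Lemma size_le_mup (K : closedFieldType) (p q : {poly K}) : p != 0 -> q != 0 ->
  (forall b, mup b p <= mup b q)%N -> (size p <= size q)%N.
Proof.
move=> p0 q0 le_pq.
have roots (g : {poly K}) : g != 0 ->
    exists2 s, size g = (size s).+1 & forall b, mup b g = count_mem b s.
  move=> g0; have [s Es] := closed_field_poly_normal g; exists s.
    by rewrite Es size_scale ?lead_coef_eq0 // size_prod_XsubC.
  move=> b; rewrite -mu_prod_XsubC Es -mul_polyC mupMr //.
  by rewrite rootC lead_coef_eq0.
have [s1 -> c1] := roots p p0; have [s2 -> c2] := roots q q0.
have /count_subseqP[s /size_subseq le_s /perm_size->] :
    forall b, (count_mem b s1 <= count_mem b s2)%N by move=> b; rewrite -c1 -c2.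
by rewrite ltnS.
Qed.

(** * Transcendence of [x - b] and [1/x], needed to construct places there *)

Section Transcendental.
Variables (K F : fieldType) (iota : {rmorphism K -> F}) (x : F).
Hypothesis trx : forall p : {poly K}, (map_poly iota p).[x] = 0 -> p = 0.

Lemma transcendental_sub b (p : {poly K}) :
  (map_poly iota p).[x - iota b] = 0 -> p = 0.
Proof.
move=> Ep; apply/eqP; rewrite -(@comp_poly2_eq0 _ p ('X - b%:P)) ?size_XsubC //.
apply/eqP/trx; rewrite map_comp_poly horner_comp rmorphB /= map_polyX map_polyC.
by rewrite !hornerE.
Qed.

Lemma transcendental_inv (p : {poly K}) : (map_poly iota p).[x^-1] = 0 -> p = 0.
Proof.
have x0 : x != 0.
  by have := subx_neq0 trx 0; rewrite rmorph0 subr0.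
(* The reversed polynomial satisfies [q(x) = p(1/x) x^(n-1)], and its constant term is the leading
   coefficient of [p]. *)
move=> Ep; set n := size p; pose q := \poly_(i < n) p`_(n.-1 - i).
have q0 : q = 0.
  apply: trx; have -> : map_poly iota q = \poly_(i < n) iota p`_(n.-1 - i).
    apply/polyP => i; rewrite coef_map !coef_poly.
    by case: ifP => // _; exact: rmorph0.
  rewrite horner_poly; transitivity ((map_poly iota p).[x^-1] * x ^+ n.-1).
    rewrite horner_coef size_map_poly -/n big_distrl (reindex_inj rev_ord_inj) /=.
    apply: eq_bigr => i _; have lt_in := ltn_ord i.
    have -> : (n.-1 - (n - i.+1) = i)%N by move: lt_in; clear; lia.
    rewrite coef_map -mulrA; congr (_ * _).
    have -> : x ^+ n.-1 = x ^+ i * x ^+ (n - i.+1).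
      by rewrite -exprD; congr (_ ^+ _); move: lt_in; clear; lia.
    by rewrite mulrA -exprMn mulVf // expr1n mul1r.
  by rewrite Ep mul0r.
apply/eqP; rewrite -size_poly_eq0; apply: contraTT isT => n0.
have := congr1 (fun g : {poly K} => g`_0) q0; rewrite coef_poly coef0 lt0n n0 subn0.
by move/eqP; rewrite -lead_coefE lead_coef_eq0 -size_poly_eq0 (negPf n0).
Qed.

End Transcendental.

(** * The inequality forced by a function with pole divisor [s P] *)

Section Gap.
Variables (K : closedFieldType) (m r : nat) (f : {poly K}).
Variables (F : fieldType) (iota : {rmorphism K -> F}) (x y : F) (alpha : K).
Variable P : pred F.
Hypothesis m_neq0 : (m%:R : K) != 0.
Hypothesis sepf : separable_poly f.
Hypothesis szf : size f = r.+1.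
Hypothesis trx : forall p : {poly K}, (map_poly iota p).[x] = 0 -> p = 0.
Hypothesis ym : y ^+ m = (map_poly iota f).[x].
Hypothesis fa : root f alpha.
Hypotheses (placeP : is_place iota P) (maP : maxideal P (x - iota alpha)).
Hypothesis genxy : forall z : F, exists p q : {poly {poly K}},
  eval2 iota x y q != 0 /\ z = eval2 iota x y p / eval2 iota x y q.

Notation ev := (evalx iota x).

Lemma pole_divisor_bound z a b s : (a < m)%N -> (m * b = s + a)%N ->
  pole_divisor_is iota z P s -> (r * a <= m * b)%N.
Proof.
move=> am Es [ordz away].
have m_gt0 : (0 < m)%N by apply: leq_trans am.
have [zeta prim] := closed_prim_root_exists m_neq0.
have f0 := separable_poly_neq0 sepf.
have y0 := y_neq0 m_gt0 sepf trx ym.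
have my := maxideal_y m_gt0 sepf ym fa placeP maP.
have uy := uniformizer_y m_gt0 sepf trx ym fa placeP maP genxy placeP maP.
have [u uu Ez] := ord_uniformizer placeP uy y0 ordz.
have [q [d [szq d0 Eqd]]] := field_repr m_gt0 sepf trx ym fa placeP maP genxy z.
have q0 : q != 0.
  apply: contra_eq_neq Ez => Eq; rewrite Eqd Eq rmorph0 mul0r eq_sym.
  by rewrite mulf_neq0 ?expfz_neq0 ?(unit_neq0 uu).
have [k [km qk0 /(_ P placeP maP)[v uv]]] := frac_order m_gt0 sepf trx ym fa szq q0 d0.
rewrite -Eqd Ez => /(unit_expz_eq placeP my y0 uu uv) Ek.
set c := q`_k in qk0 Ek *.
(* The order [- s = a - m b] of [z] determines the index [k] modulo [m]. *)
have Eka : k = a.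
  have Ekm : (k + m * (mup alpha c + b) = a + m * mup alpha d)%N.
    by move: Ek Es; rewrite mulnDr; clear; lia.
  move/(congr1 (modn^~ m)): Ekm.
  by rewrite ![(_ + m * _)%N]addnC ![(m * _)%N]mulnC !modnMDl !modn_small.
have mupd : mup alpha d = (mup alpha c + b)%N.
  apply/eqP; rewrite -(eqn_pmul2l m_gt0) mulnDr; apply/eqP.
  by move: Ek Es; rewrite Eka; clear; lia.
(* The component [c y^a / d] is regular at [Q]; its [m]-th power lies in [K(x)], where orders are
   read off from polynomials. *)
have inQ Q h1 h2 : is_place iota Q -> (x - iota alpha)^-1 \in Q ->
    ev h1 / ev h2 \notin Q -> ev (c ^+ m * f ^+ a) / ev (d ^+ m) \in Q.
  move=> placeQ Qa nQh.
  move: (away); rewrite Eqd => away'.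
  have := component_in_place m_gt0 sepf trx ym fa placeP maP genxy placeQ Qa nQh
    szq away' prim m_neq0 am.
  rewrite -Eka => /(placeX placeQ m).
  by rewrite expr_div_n exprMn -exprM mulnC exprM ym !rmorphM !rmorphXn.
have cf0 : c ^+ m * f ^+ a != 0 by rewrite mulf_neq0 ?expf_neq0.
have dm0 : d ^+ m != 0 by rewrite expf_neq0.
have mupX b' (g : {poly K}) n : g != 0 -> mup b' (g ^+ n) = (n * mup b' g)%N.
  move=> g0; elim: n => [|n IHn]; first by rewrite expr0 mupNroot ?root1.
  by rewrite exprS mupM ?expf_neq0 // IHn mulSn.
(* Regularity gives [m mup(d) <= m mup(c) + a mup(f)]; since [mup(f) <= 1] and [a < m], the last
   term cannot make up for a missing multiple of [m]. *)
have mup_le b' : b' != alpha -> (mup b' d <= mup b' c)%N.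
  move=> neq.
  have [Q placeQ mQ] := exists_place_maxideal (transcendental_sub trx (b := b')).
  have Qa : (x - iota alpha)^-1 \in Q.
    have [] // := unitD_max placeQ (_ : unit_in Q (iota (b' - alpha))) mQ.
      by apply: (unit_const placeQ); rewrite subr_eq0.
    by move=> _ _; rewrite rmorphB addrC addrA subrK.
  have nQ : ev 1 / ev ('X - b'%:P) \notin Q.
    by rewrite rmorph1 mul1r evalx_XsubC (maxideal_notin (subx_neq0 trx b') mQ).
  have := mup_le_place trx placeQ mQ cf0 dm0 (inQ _ _ _ placeQ Qa nQ).
  rewrite mupM ?expf_neq0 // !mupX // => le1.
  have := mup_separable sepf b'; rewrite leqNgt; move: le1 am m_gt0; clear.
  move=> le1 am m0 le_f; rewrite leqNgt; apply/negP => lt; nia.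
(* Every root multiplicity of [d] is bounded by that of [c (X - alpha)^b], with equality at
   [alpha]. *)
have sz_d : (size d <= size c + b)%N.
  have e0 : c * ('X - alpha%:P) ^+ b != 0.
    by rewrite mulf_neq0 ?expf_neq0 ?polyXsubC_eq0.
  have := size_le_mup d0 e0; rewrite size_mul ?expf_neq0 ?polyXsubC_eq0 //.
  rewrite size_exp_XsubC addnS; apply => b'.
  rewrite mupM ?expf_neq0 ?polyXsubC_eq0 // mup_XsubCX.
  have [<-|neq] := eqVneq alpha b'; first by rewrite mupd.
  by rewrite addn0 mup_le // eq_sym.
(* At a place above infinity, regularity reads [m deg c + r a <= m deg d], to be combined with
   [deg d <= deg c + b]. *)
have [Q placeQ mQ] := exists_place_maxideal (transcendental_inv trx).
have nQx : x \notin Q.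
  have x0 : x != 0 by have := subx_neq0 trx 0; rewrite rmorph0 subr0.
  by rewrite -[x]invrK (maxideal_notin _ mQ) ?invr_eq0.
have Qa : (x - iota alpha)^-1 \in Q.
  apply: (placeV placeQ); apply: contra nQx => Qx.
  by rewrite -[x](subrK (iota alpha)) (placeD placeQ) ?(place_const placeQ).
have nQ : ev 'X / ev 1 \notin Q by rewrite rmorph1 divr1 evalxE map_polyX hornerX.
have := inQ _ _ _ placeQ Qa nQ; rewrite (size_le_place placeQ nQx cf0 dm0).
rewrite size_mul ?expf_neq0 //.
have := size_exp c m; have := size_exp f a; have := size_exp d m; rewrite szf /=.
have := size_poly_gt0 (c ^+ m); have := size_poly_gt0 (f ^+ a).
have := size_poly_gt0 (d ^+ m); rewrite !expf_neq0 //.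
have := size_poly_gt0 c; rewrite qk0; have := size_poly_gt0 d; rewrite d0.
move=> sd sc sdm sfa scm Ed Ef Ec le_sz.
have : (m * (size d).-1 <= m * ((size c).-1 + b))%N.
  by rewrite leq_mul2l; apply/orP; right; move: sz_d sc sd; clear; lia.
rewrite mulnDr; move: sdm sfa scm Ed Ef Ec le_sz; rewrite ![(_ * m)%N]mulnC.
move: (size (d ^+ m)) (size (f ^+ a)) (size (c ^+ m)) => D B A.
move: (m * (size d).-1)%N (m * (size c).-1)%N (r * a)%N (m * b)%N; clear; lia.
Qed.

End Gap.

(** The bounds on [i] and [j] are written additively because subtraction on [nat] truncates. The
    proof takes [a = m - 1 - i] and [b = j + 1], so that [s = m b - a]. *)
Theorem mainTheorem12 (K : closedFieldType) (m r : nat) (f : {poly K})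
    (F : fieldType) (iota : {rmorphism K -> F}) (x y : F) (alpha : K) (P : pred F) :
  (2 <= m)%N -> (m%:R : K) != 0 ->
  separable_poly f -> size f = r.+1 ->
  (forall p : {poly K}, (map_poly iota p).[x] = 0 -> p = 0) ->
  y ^+ m = (map_poly iota f).[x] ->
  (forall z : F, exists p q : {poly {poly K}},
      eval2 iota x y q != 0 /\ z = eval2 iota x y p / eval2 iota x y q) ->
  genus_ge1 iota ->
  root f alpha -> is_place iota P -> maxideal P (x - iota alpha) ->
  forall s : nat,
    gap iota P s <->
    exists i j : nat,
      [/\ (i + 2 + m %/ r <= m)%N,
          (j + 2 + (r * (i + 1)) %/ m <= r)%N &
          s = (1 + i + m * j)%N].
Proof.
move=> m_ge2 m0 sepf szf trx ym genxy _ fa placeP maP s.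
have m_gt0 : (0 < m)%N by exact: ltnW.
have r_gt0 : (0 < r)%N.
  have f0 := separable_poly_neq0 sepf; rewrite -ltnS -szf.
  exact: root_size_gt1 fa.
split=> [[s0 nopole]|[i [j [le_i le_j Es]]]].
  have [i [j [im Es]]] : exists i j : nat, (i < m)%N /\ s = (1 + i + m * j)%N.
    exists (s.-1 %% m)%N, (s.-1 %/ m)%N; rewrite ltn_mod; split => //.
    by rewrite -addnA addnC addn1 addnC mulnC -divn_eq prednK.
  have lt_ab : (m * j.+1 < r * (m.-1 - i))%N.
    rewrite ltnNge; apply/negP => le_ab; apply: nopole; eexists.
    apply: (monomial_pole_divisor m_gt0 sepf trx ym fa placeP maP genxy szf le_ab).
    by rewrite Es mulnS; move: im; clear; lia.
  (* Substituting [a = m - (i + 1)] into [m b < r a] and moving terms across gives the bound on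
     [j]. *)
  have bound : (r * (i + 1) < m * (r - j.+1))%N.
    have E : (m.-1 - i = m - (i + 1))%N by move: im; clear; lia.
    move: lt_ab; rewrite {}E !mulnBr [(m * r)%N]mulnC; clear.
    by move: (m * _)%N (r * _)%N (r * _)%N; lia.
  have lt_div : (r * (i + 1) %/ m < r - j.+1)%N by rewrite ltn_divLR // [ltnRHS]mulnC.
  (* The bound on [i] comes from [m <= m (j + 1) < r (m - 1 - i)]. *)
  have div_r : (m %/ r < m - i.+1)%N.
    by rewrite ltn_divLR //; move: lt_ab im; clear; nia.
  exists i, j; split => //.
    by move: div_r im; move: (m %/ r)%N; clear; lia.
  by move: lt_div; move: (_ %/ m)%N; clear; lia.
(* Conversely, the bound on [j] alone yields [m b < r a], contradicting [pole_divisor_bound]. *)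
have lt_div : (r * (i + 1) %/ m < r - j.+1)%N.
  by move: le_j; move: (_ %/ m)%N; clear; lia.
rewrite ltn_divLR // in lt_div.
have im : (i + 1 < m)%N by move: le_i; move: (m %/ r)%N; clear; lia.
split; first by rewrite Es.
case=> z pole.
have am : (m - (i + 1) < m)%N by move: m_gt0; clear; lia.
have Eb : (m * j.+1 = s + (m - (i + 1)))%N by rewrite Es mulnS; move: im; clear; lia.
have := pole_divisor_bound m0 sepf szf trx ym fa placeP maP genxy am Eb pole.
move: lt_div; rewrite mulnBl mulnBr [(j.+1 * m)%N]mulnC; clear.
by move: (r * m)%N (m * _)%N (r * _)%N; lia.
Qed.
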